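(* Let $V(0)>0$ and $w\in\mathcal W$ be given, and let $n\ge 1$. If the weight vector $w$ satisfies $$\sum_{i=1}^m w_i\,\mathcal X_{\min,i}+c(w)>0,$$ then for every $\varepsilon\ge 0$ and every distribution $\mathbb F\in\mathcal B_\varepsilon(\widehat{\mathbb F})$ we have $$\mathbb P^{\mathbb F}\bigl(V(n)>0\bigr)=1,$$ where $V(n)=V(0)\bigl(c(w)+w^\top\mathcal X_n\bigr)$ and, under $\mathbb P^{\mathbb F}$, the random vector $\mathcal X_n$ has distribution $\mathbb F$.
   Context: Setting. $m\ge1$ is the number of assets, $n\ge 1$ is the (integer) number of steps between rebalancings, and $V(0)>0$ is the initial account value. $\mathcal W:=\{w\in\mathbb R^m: \mathbf 1^\top w=1,\ w_i\ge 0\ \text{for all } i\}$. Returns. For each $i$, real per-period return bounds $-1<X_{\min,i}\le X_{\max,i}<\infty$ are given; $\mathcal X_{\min,i}:=(1+X_{\min,i})^n-1>-1$ and $\mathcal X_{\max,i}:=(1+X_{\max,i})^n-1<\infty$. The support set of the $n$-period compound return vector $\mathcal X_n$ is the box $\mathfrak X:=\{x\in\mathbb R^m:\mathcal X_{\min,i}\le x_i\le\mathcal X_{\max,i},\ i=1,\dots,m\}$. Transaction costs. For each $i$, $TC_i$ is a continuous convex real-valued function of the amount invested in asset $i$; for $w\in\mathcal W$ the amounts are $u_i=w_iV(0)$, and the total cost $\sum_{i=1}^m TC_i(w_iV(0))$ lies in $[0,V(0))$. Define $c(w):=1-\frac{1}{V(0)}\sum_{i=1}^m TC_i(w_iV(0))$.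 Ambiguity set. Fix a norm $\|\cdot\|$ on $\mathbb R^m$. $\mathcal M(\mathfrak X)$ is the set of Borel probability distributions $\mathbb F$ supported on $\mathfrak X$ with $\int\|x\|\,d\mathbb F(x)<\infty$. The type-1 Wasserstein metric is $d(\mathbb F^1,\mathbb F^2):=\inf_\Pi \mathbb E_{(\mathcal X^1,\mathcal X^2)\sim\Pi}[\|\mathcal X^1-\mathcal X^2\|]$, the infimum over all joint distributions $\Pi$ with marginals $\mathbb F^1,\mathbb F^2$. Given samples $\widehat{\mathcal X}_1,\dots,\widehat{\mathcal X}_N\in\mathfrak X$ ($N\ge1$), the empirical distribution is $\widehat{\mathbb F}:=\frac1N\sum_{j=1}^N\delta_{\widehat{\mathcal X}_j}$, where $\delta_x$ is the Dirac distribution at $x$, and $\mathcal B_\varepsilon(\widehat{\mathbb F}):=\{\mathbb F\in\mathcal M(\mathfrak X): d(\mathbb F,\widehat{\mathbb F})\le\varepsilon\}$. *)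

(* Defs.v *)
From HB Require Import structures.
From mathcomp Require Import all_boot all_order all_algebra.
From mathcomp Require Import all_classical all_reals all_analysis.

Set Implicit Arguments.
Unset Strict Implicit.
Unset Printing Implicit Defensive.

Import Order.TTheory GRing.Theory Num.Theory.
Import numFieldNormedType.Exports.

Local Open Scope classical_set_scope.
Local Open Scope ring_scope.

(* R^m with its Borel sigma-algebra; a notation rather than a definition, so
   that the instances on g_sigma_algebraType are found by unification. *)
Notation borel_rV R m :=
  (g_sigma_algebraType (open : set (set (matrix (Real.sort R) 1 m)))).

Section vectors.
Context (R : realType) (m : nat).
Implicit Types (w x y : 'rV[R]_m).

(* An arbitrary norm on R^m: the norm `|x| that the library attaches to 'rV_m
   is the sup norm only. *)
Record is_norm (nrm : 'rV[R]_m -> R) : Prop := IsNorm {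
  is_norm_triangle : forall x y, nrm (x + y) <= nrm x + nrm y;
  is_norm_homogeneous : forall (a : R) x, nrm (a *: x) = `|a| * nrm x;
  is_norm_definite : forall x, nrm x = 0 -> x = 0 }.

Definition dotr w x : R := \sum_(i < m) w 0 i * x 0 i.

Definition weights : set 'rV[R]_m :=
  [set w | \sum_(i < m) w 0 i = 1 /\ forall i, 0 <= w 0 i].

Definition compound_bound (n : nat) (r : R) : R := (1 + r) ^+ n - 1.

Definition support_box (n : nat) (Xmin Xmax : 'I_m -> R) : set 'rV[R]_m :=
  [set x | forall i,
     compound_bound n (Xmin i) <= x 0 i <= compound_bound n (Xmax i)].

Definition total_cost (V0 : R) (TC : 'I_m -> R -> R) w : R :=
  \sum_(i < m) TC i (w 0 i * V0).

Definition net_factor (V0 : R) (TC : 'I_m -> R -> R) w : R :=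
  1 - V0^-1 * total_cost V0 TC w.

Definition account_value (V0 : R) (TC : 'I_m -> R -> R) w x : R :=
  V0 * (net_factor V0 TC w + dotr w x).

End vectors.

Section empirical.
Context d (T : measurableType d) (R : realType) (N : nat).
Local Open Scope ereal_scope.

(* N_gt0 is not used by the value; it lets the total mass 1 be recorded as a
   canonical instance. *)
Definition empirical (N_gt0 : (0 < N)%N) (s : 'I_N -> T) (A : set T) : \bar R :=
  (N%:R^-1)%:E * \sum_(j < N) (\d_(s j))%R A.

Variables (N_gt0 : (0 < N)%N) (s : 'I_N -> T).
Local Notation emp := (empirical N_gt0 s).

Let emp0 : emp set0 = 0.
Proof. by rewrite /empirical big1 ?mule0// => j _; rewrite measure0. Qed.

Let emp_ge0 A : 0 <= emp A.
Proof.
by apply: mule_ge0; [rewrite lee_fin invr_ge0 | exact: sume_ge0].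
Qed.

Let emp_sigma_additive : semi_sigma_additive emp.
Proof.
move=> F mF tF mUF.
pose mu : {measure set T -> \bar R} :=
  msum (fun k => (\d_(s (insubd (Ordinal N_gt0) k)))%R) N.
have empE A : emp A = (N%:R^-1)%:E * mu A.
  rewrite /empirical /mu /= /msum; congr (_ * _).
  by apply: eq_bigr => j _; rewrite valKd.
have /cvgeZl H := @measure_semi_sigma_additive _ _ _ mu F mF tF mUF.
rewrite empE [X in X @ _ --> _](_ : _ =
    (fun k => (N%:R^-1)%:E * \sum_(0 <= i < k) mu (F i))).
  exact: H.
apply/funext => k; rewrite ge0_sume_distrr//.
by apply: eq_bigr => i _; rewrite empE.
Qed.

HB.instance Definition _ := isMeasure.Build _ _ _ emp
  emp0 emp_ge0 emp_sigma_additive.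

Let emp_setT : emp setT = 1.
Proof.
rewrite /empirical (eq_bigr (fun=> 1)); last first.
  by move=> j _; rewrite diracE in_setT.
rewrite sumEFin sumr_const card_ord -EFinM mulVf//.
by rewrite pnatr_eq0 -lt0n.
Qed.

HB.instance Definition _ := Measure_isProbability.Build _ _ _ emp emp_setT.

End empirical.
Arguments empirical {d T R N} N_gt0 s A.

Section wasserstein.
Context (R : realType) (m : nat).
Local Notation T := (borel_rV R m).
Local Open Scope ereal_scope.

Definition coupling (F1 F2 : probability T R)
    : set (probability (T * T)%type R) :=
  [set Pi | forall A : set T, measurable A ->
     Pi (A `*` setT) = F1 A /\ Pi (setT `*` A) = F2 A].

Definition wasserstein1 (nrm : 'rV[R]_m -> R) (F1 F2 : probability T R)
    : \bar R :=
  ereal_inf [set \int[Pi]_z (nrm (z.1 - z.2)%R)%:E | Pi in coupling F1 F2].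

(* On the closed set S, the support of F is included in S iff F S = 1. *)
Definition finite_moment_dist (nrm : 'rV[R]_m -> R) (S : set 'rV[R]_m)
    : set (probability T R) :=
  [set F : probability T R | F S = 1 /\ \int[F]_x (nrm x)%:E < +oo].

Definition wasserstein_ball (nrm : 'rV[R]_m -> R) (S : set 'rV[R]_m)
    (F0 : probability T R) (eps : R) : set (probability T R) :=
  [set F : probability T R |
     finite_moment_dist nrm S F /\ wasserstein1 nrm F F0 <= eps%:E].

End wasserstein.

(* Main.v *)
Require Import Defs.
From mathcomp Require Import all_boot all_order all_algebra.
From mathcomp Require Import all_classical all_reals all_analysis.

Import Order.TTheory GRing.Theory Num.Theory.
Import numFieldNormedType.Exports.

Local Open Scope classical_set_scope.
Local Open Scope ring_scope.

(** Every distribution in the ball gives the box mass 1, whatever the radius, so it suffices that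
    the account value is positive at each point of the box. As the weights are nonnegative,
    [dotr w x] is bounded below on the box by its value at the corner of the lower bounds, where the
    hypothesis gives positivity ([account_value_gt0]). The positivity set thus contains a set of
    mass 1. Monotonicity of the measure needs both sets to be Borel: the box is closed
    ([closed_support_box]), the positivity set is open ([open_account_value_gt0]). *)

Lemma closed_support_box (R : realType) (m n : nat) (Xmin Xmax : 'I_m -> R) :
  closed (support_box n Xmin Xmax).
Proof.
rewrite (_ : support_box n Xmin Xmax = \bigcap_(i in setT)
    ((fun x : 'rV[R]_m => x 0 i) @^-1`
       `[compound_bound n (Xmin i), compound_bound n (Xmax i)])).
  apply: closed_bigI => i _; apply: preimage_closed => [x _|].
    exact: coord_continuous.
  exact: interval_closed.
apply/seteqP; split => [x /= Hx i _|x /= Hx i]; rewrite ?in_itv /=.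
  exact: Hx.
by have := Hx i I; rewrite /= in_itv.
Qed.

Lemma continuous_dotr (R : realType) (m : nat) (w : 'rV[R]_m) :
  continuous (dotr w).
Proof.
apply: continuous_big => [|i _ x]; first exact: add_continuous.
apply: (@continuous_comp _ _ _ (fun y : 'rV_m => y 0 i) ( *%R (w 0 i))).
  exact: coord_continuous.
exact: mulrl_continuous.
Qed.

Lemma open_account_value_gt0 (R : realType) (m : nat) (V0 : R)
    (TC : 'I_m -> R -> R) (w : 'rV[R]_m) :
  open [set x | 0 < account_value V0 TC w x].
Proof.
apply: (@open_comp _ _ (account_value V0 TC w) [set y | 0 < y]) => [x _|].
  apply: (@continuous_comp _ _ _ (dotr w)
    (fun y => V0 * (net_factor V0 TC w + y))); first exact: continuous_dotr.
  by apply: cvgMl_tmp; apply: cvgD; [exact: cvg_cst|exact: cvg_id].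
exact: open_gt.
Qed.

Lemma account_value_gt0 (R : realType) (m n : nat) (V0 : R)
    (Xmin Xmax : 'I_m -> R) (TC : 'I_m -> R -> R) (w x : 'rV[R]_m) :
  0 < V0 -> weights w ->
  0 < \sum_(i < m) w 0 i * compound_bound n (Xmin i) + net_factor V0 TC w ->
  support_box n Xmin Xmax x -> 0 < account_value V0 TC w x.
Proof.
move=> V0_gt0 [_ w_ge0] pos xbox; rewrite /account_value mulr_gt0//.
(* The net factor cancels, leaving a termwise comparison with the lower corner, where [w_ge0]
   preserves each inequality. *)
apply: (lt_le_trans pos); rewrite addrC lerD2l; apply: ler_sum => i _.
by apply: ler_wpM2l => //; have /andP[] := xbox i.
Qed.

Theorem lemma2p4 (R : realType) (m : nat) (hm : (0 < m)%N)
  (n : nat) (hn : (0 < n)%N)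
  (V0 : R) (hV0 : 0 < V0)
  (Xmin Xmax : 'I_m -> R)
  (hX : forall i, -1 < Xmin i /\ Xmin i <= Xmax i)
  (TC : 'I_m -> R -> R)
  (hTC_cont : forall i, {within `[0, +oo[, continuous (TC i)})
  (hTC_conv : forall i,
     convex_function (`[0, +oo[%classic : set R) (TC i))
  (hTC_range : forall w : 'rV[R]_m, weights w -> 0 <= total_cost V0 TC w < V0)
  (nrm : 'rV[R]_m -> R) (hnrm : is_norm nrm)
  (N : nat) (hN : (0 < N)%N) (sample : 'I_N -> borel_rV R m)
  (hsample : forall j, support_box n Xmin Xmax (sample j))
  (w : 'rV[R]_m) (hw : weights w)
  (hpos : 0 < \sum_(i < m) w 0 i * compound_bound n (Xmin i)
              + net_factor V0 TC w)
  (eps : R) (heps : 0 <= eps)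
  (F : probability (borel_rV R m) R)
  (hF : wasserstein_ball nrm (support_box n Xmin Xmax) (empirical hN sample)
          eps F)
  (d : measure_display) (Omega : measurableType d) (P : probability Omega R)
  (Xn : {RV P >-> borel_rV R m})
  (hXn : forall A : set (borel_rV R m), measurable A ->
     distribution P Xn A = F A) :
  P [set omega | 0 < account_value V0 TC w (Xn omega)] = 1%E.
Proof.
have [[Fbox _] _] := hF.
set S := support_box n Xmin Xmax in Fbox.
pose B : set (borel_rV R m) := [set x | 0 < account_value V0 TC w x].
have mB : measurable B.
  by apply: sub_sigma_algebra; exact: open_account_value_gt0.
have mS : measurable (S : set (borel_rV R m)).
  rewrite -[S]setCK; apply: measurableC; apply: sub_sigma_algebra.
  by apply: closed_openC; exact: closed_support_box.
(* The event is the preimage of [B] under [Xn], so its probability is by conversion the mass of [B]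
   under the law of [Xn], which is [F]. *)
change (distribution P Xn B = 1%E); rewrite hXn//.
(* Writing 1 as the mass of the box turns the lower bound into the inclusion of [S] in [B]. *)
apply/eqP; rewrite eq_le probability_le1//= -Fbox.
apply: le_measure; rewrite ?inE// => x.
exact: account_value_gt0.
Qed.
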